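(* Let $\xi\in\mathbb{Z}\setminus\{0\}$ and let $a,b\in\mathbb{Z}$ with $b\neq 0$; put $\Lambda(x)=a-bx$. Let $T\subseteq\mathbb{P}$ be a set of primes such that for every finite subset $S$ of $T$, the set $R=T\setminus S$ satisfies $$\limsup_{n\to\infty} c^n\, n!\prod_{p\in R}|n!|_p^2=0,\qquad\text{where } c=c(\xi;R):=4|\xi|\prod_{p\in R}|\xi|_p^2 .$$ Then there exist infinitely many primes $p\in T$ such that $\Lambda(F_p(\xi))\neq 0$.
   Context: $\mathbb{P}$ denotes the set of all prime numbers. For a prime $p$, $|\cdot|_p$ is the $p$-adic absolute value normalized by $|p|_p=p^{-1}$, and $\mathbb{Q}_p$ is the completion of $\mathbb{Q}$ with respect to it. For $z\in\mathbb{Q}_p$ with $|z|_p\le 1$ the series $F_p(z):=\sum_{n=0}^\infty n!\,z^n$ (Euler's factorial series) converges in $\mathbb{Q}_p$, and $F_p(z)\in\mathbb{Q}_p$ denotes its sum. The products over $p\in R$ have only finitely many factors different from $1$, and the constant $c(\xi;R)$ depends on the set $R$ (here $R=T\setminus S$). *)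

(* Defs.v *)
From HB Require Import structures.
From mathcomp Require Import all_boot all_order all_algebra.
From mathcomp Require Import all_classical all_reals all_analysis.

Set Implicit Arguments.
Unset Strict Implicit.
Unset Printing Implicit Defensive.

Import Order.TTheory GRing.Theory Num.Theory.
Import numFieldNormedType.Exports.

Local Open Scope classical_set_scope.
Local Open Scope ring_scope.

Record prime_number := PrimeNumber {
  prime_val :> nat;
  prime_valP : prime prime_val }.

HB.instance Definition _ := [isSub for prime_val].
HB.instance Definition _ := [Countable of prime_number by <:].

Definition padic_val (p : nat) (x : rat) : int :=
  (logn p `|numq x|%N)%:Z - (logn p `|denq x|%N)%:Z.

Definition padic_abs (R : realType) (p : nat) (x : rat) : R :=
  if x == 0 then 0 else p%:R ^ (- padic_val p x).

Section PadicAbs.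
Variables (R : realType) (p : prime_number).
Implicit Types x y : rat.
Local Notation abs := (padic_abs R p).

Let p_pr : prime p := prime_valP p.

Let p_gt0 : (0 : R) < p%:R.
Proof. by rewrite ltr0n prime_gt0. Qed.

Let p_ge1 : (1 : R) <= p%:R.
Proof. by rewrite ler1n prime_gt0. Qed.

Let p_neq0 : (p%:R : R) != 0.
Proof. by rewrite gt_eqF. Qed.

Lemma padic_abs0 : abs 0 = 0.
Proof. by rewrite /padic_abs eqxx. Qed.

Lemma padic_abs_neq0 x : x != 0 -> abs x = p%:R ^ (- padic_val p x).
Proof. by rewrite /padic_abs => /negPf ->. Qed.

Lemma padic_abs_ge0 x : 0 <= abs x.
Proof. by rewrite /padic_abs; case: ifP => // _; rewrite exprz_ge0// ltW. Qed.

Lemma padic_abs_gt0 x : (0 < abs x) = (x != 0).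
Proof.
have [->|x0] := eqVneq x 0; first by rewrite padic_abs0 ltxx.
by rewrite padic_abs_neq0// exprz_gt0.
Qed.

Lemma padic_abs_eq0 x : (abs x == 0) = (x == 0).
Proof.
by apply/negb_inj; rewrite -padic_abs_gt0 lt_def padic_abs_ge0 andbT.
Qed.

Lemma padic_val_frac (a b : int) : a != 0 -> b != 0 ->
  padic_val p (a%:~R / b%:~R) = (logn p `|a|%N)%:Z - (logn p `|b|%N)%:Z.
Proof.
move=> a0 b0; set x := (_ / _ : rat).
have x0 : x != 0 by rewrite mulf_neq0 ?invr_eq0 ?intr_eq0.
have e : numq x * b = a * denq x.
  apply: (@intr_inj rat); rewrite !rmorphM/=.
  have dx : (denq x)%:~R != 0 :> rat by rewrite intr_eq0 denq_neq0.
  have nx : (numq x)%:~R = x * (denq x)%:~R by rewrite numqE.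
  rewrite nx /x mulrAC divfK ?intr_eq0//.
have e2 : (logn p `|numq x| + logn p `|b| = logn p `|a| + logn p `|denq x|)%N.
  rewrite -!lognM ?absz_gt0 ?numq_eq0 ?denq_neq0// -!abszM; congr logn.
  by rewrite e.
rewrite /padic_val; apply/eqP; rewrite subr_eq addrAC eq_sym subr_eq.
by rewrite -!PoszD e2.
Qed.

Lemma padic_valM x y : x != 0 -> y != 0 ->
  padic_val p (x * y) = padic_val p x + padic_val p y.
Proof.
move=> x0 y0.
rewrite -{1}[x]divq_num_den -{1}[y]divq_num_den mulf_div -!rmorphM/=.
rewrite padic_val_frac ?mulf_neq0 ?numq_eq0 ?denq_neq0//.
rewrite !abszM !lognM ?absz_gt0 ?numq_eq0 ?denq_neq0// !PoszD.
by rewrite opprD addrACA.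
Qed.

Lemma padic_absM x y : abs (x * y) = abs x * abs y.
Proof.
have [->|x0] := eqVneq x 0; first by rewrite mul0r padic_abs0 mul0r.
have [->|y0] := eqVneq y 0; first by rewrite mulr0 padic_abs0 mulr0.
rewrite !padic_abs_neq0 ?mulf_neq0// padic_valM// opprD expfzDr//.
Qed.

Lemma padic_abs1 : abs 1 = 1.
Proof.
by rewrite padic_abs_neq0 ?oner_eq0// /padic_val !logn1 subrr.
Qed.

Lemma padic_absN x : abs (- x) = abs x.
Proof.
have N1 : abs (-1) = 1.
  rewrite padic_abs_neq0 ?oppr_eq0 ?oner_eq0//.
  by rewrite (_ : -1 = (-1)%:~R / 1%:~R)// padic_val_frac//= !logn1 subrr.
by rewrite -mulN1r padic_absM N1 mul1r.
Qed.

Lemma padic_absV x : abs x^-1 = (abs x)^-1.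
Proof.
have [->|x0] := eqVneq x 0; first by rewrite invr0 padic_abs0 invr0.
apply: (@mulfI _ (abs x)); first by rewrite padic_abs_eq0.
by rewrite -padic_absM !divff ?padic_abs_eq0// padic_abs1.
Qed.

Lemma padic_abs_int (a : int) : abs a%:~R <= 1.
Proof.
have [->|a0] := eqVneq a 0; first by rewrite padic_abs0.
rewrite padic_abs_neq0 ?intr_eq0// -[a%:~R]divr1.
rewrite (_ : 1 = 1%:~R)// padic_val_frac// logn1 subr0.
by rewrite -invr_expz -exprnP invf_le1 ?exprn_gt0// exprn_ege1.
Qed.

Lemma padic_absD_le x y : abs x <= abs y -> abs (x + y) <= abs y.
Proof.
have [->|y0] := eqVneq y 0.
  rewrite padic_abs0 le_eqVlt ltNge padic_abs_ge0 orbF padic_abs_eq0.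
  by move=> /eqP->; rewrite addr0 padic_abs0.
move=> xy; pose z := x / y.
have zle : abs z <= 1.
  by rewrite padic_absM padic_absV ler_pdivrMr ?padic_abs_gt0// mul1r.
have -> : x + y = (z + 1) * y by rewrite mulrDl mul1r divfK.
rewrite padic_absM ler_piMl ?padic_abs_ge0//.
have dz : ~~ (p %| `|denq z|)%N.
  apply/negP => pd; move: zle.
  have z0 : z != 0.
    apply/eqP => z0; move: pd; rewrite z0 dvdn1.
    by move/eqP => p1; move: p_pr; rewrite p1.
  have pn : ~~ (p %| `|numq z|)%N.
    apply/negP => pn; have := coprime_num_den z.
    move/(coprime_dvdl pn)/(coprime_dvdr pd).
    by rewrite /coprime gcdnn => /eqP p1; move: p_pr; rewrite p1.
  rewrite padic_abs_neq0// /padic_val (logn_coprime _ (m := `|numq z|)); last first.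
    by rewrite prime_coprime.
  rewrite sub0r opprK -exprnP leNgt exprn_egt1 ?ltr1n ?prime_gt1//.
  by rewrite -lt0n logn_gt0 mem_primes p_pr pd absz_gt0 denq_neq0.
have -> : z + 1 = (numq z + denq z)%:~R / (denq z)%:~R.
  rewrite rmorphD/= mulrDl divff ?intr_eq0 ?denq_neq0//.
  by rewrite divq_num_den.
rewrite padic_absM padic_absV.
have -> : abs (denq z)%:~R = 1.
  rewrite padic_abs_neq0 ?intr_eq0 ?denq_neq0// -[X in padic_val _ X]divr1.
  rewrite (_ : 1 = 1%:~R)// padic_val_frac ?denq_neq0// logn1 subr0.
  by rewrite logn_coprime ?prime_coprime.
by rewrite invr1 mulr1 padic_abs_int.
Qed.

Lemma padic_absD x y : abs (x + y) <= Num.max (abs x) (abs y).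
Proof.
rewrite le_max; have [xy|/ltW yx] := leP (abs x) (abs y).
  by rewrite (padic_absD_le xy) orbT.
by rewrite addrC (padic_absD_le yx).
Qed.

Lemma padic_abs_triangle x y : abs (x + y) <= abs x + abs y.
Proof.
rewrite (le_trans (padic_absD x y))// ge_max lerDl lerDr.
by rewrite !padic_abs_ge0.
Qed.

Lemma padic_abs_dist x y : `|abs x - abs y| <= abs (x - y).
Proof.
rewrite ler_norml; apply/andP; split; last first.
  by rewrite lerBlDr -{1}[x](subrK y) padic_abs_triangle.
rewrite lerNl opprB lerBlDr -{1}[y](subrK x) -(padic_absN (x - y)) opprB.
exact: padic_abs_triangle.
Qed.

End PadicAbs.

Definition padic_cauchy (R : realType) (p : nat) : pred (nat -> rat) := fun u =>
  `[< forall e : R, 0 < e -> exists N, forall m n, (N <= m)%N -> (N <= n)%N ->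
      padic_abs R p (u m - u n) < e >].

Record cauchy_seq (R : realType) (p : prime_number) := CauchySeq {
  cauchy_seq_val :> nat -> rat;
  cauchy_seq_valP : padic_cauchy R p cauchy_seq_val }.

HB.instance Definition _ R p := [isSub for @cauchy_seq_val R p].
HB.instance Definition _ R p := [Choice of cauchy_seq R p by <:].

Section CauchySeq.
Variables (R : realType) (p : prime_number).
Local Notation abs := (padic_abs R p).

Lemma padic_cauchyP (u : nat -> rat) :
  reflect (forall e : R, 0 < e -> exists N, forall m n,
     (N <= m)%N -> (N <= n)%N -> abs (u m - u n) < e)
  (u \in padic_cauchy R p).
Proof. exact: asboolP. Qed.

Lemma padic_cauchy_bounded (u : nat -> rat) : u \in padic_cauchy R p ->
  exists2 M : R, 0 < M & forall n, abs (u n) <= M.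
Proof.
move=> /padic_cauchyP /(_ 1 ltr01) [N uN].
exists (1 + \sum_(i < N.+1) abs (u i)).
  by rewrite ltr_pwDl// sumr_ge0// => i _; exact: padic_abs_ge0.
move=> n; have le_sum m : (m <= N)%N -> abs (u m) <= \sum_(i < N.+1) abs (u i).
  move=> mN; have mN' : (m < N.+1)%N by [].
  rewrite (bigD1 (Ordinal mN'))//= lerDl sumr_ge0// => i _.
  exact: padic_abs_ge0.
have [nN|/ltnW Nn] := leqP n N.
  by rewrite (le_trans (le_sum _ nN))// lerDr.
rewrite -[u n](subrK (u N)) (le_trans (padic_abs_triangle _ _ _ _))//.
by rewrite lerD ?le_sum// ltW// uN.
Qed.

Lemma padic_cauchy_subring : subring_closed (padic_cauchy R p).
Proof.
split.
- apply/padic_cauchyP => e e0; exists 0 => m n _ _.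
  by rewrite subrr padic_abs0.
- move=> u v /padic_cauchyP cu /padic_cauchyP cv.
  apply/padic_cauchyP => e e0.
  have [N1 uN] := cu _ e0; have [N2 vN] := cv _ e0.
  exists (maxn N1 N2) => m n; rewrite !geq_max => /andP[m1 m2] /andP[n1 n2].
  rewrite (_ : _ - _ = (u m - u n) - (v m - v n)); last first.
    by rewrite !fctE opprD addrACA -opprD.
  rewrite (le_lt_trans (padic_absD _ _ _ _))// padic_absN gt_max.
  by rewrite uN// vN.
- move=> u v cu cv.
  have [M M0 uM] := padic_cauchy_bounded cu.
  have [K K0 vK] := padic_cauchy_bounded cv.
  move/padic_cauchyP: cu => cu; move/padic_cauchyP: cv => cv.
  apply/padic_cauchyP => e e0.
  have [N1 uN] := cu _ (divr_gt0 e0 K0); have [N2 vN] := cv _ (divr_gt0 e0 M0).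
  exists (maxn N1 N2) => m n; rewrite !geq_max => /andP[m1 m2] /andP[n1 n2].
  rewrite (_ : _ - _ = u m * (v m - v n) + (u m - u n) * v n); last first.
    by rewrite !fctE mulrBr mulrBl addrA subrK.
  rewrite (le_lt_trans (padic_absD _ _ _ _))// !padic_absM gt_max.
  apply/andP; split.
    by rewrite (le_lt_trans (ler_wpM2r _ (uM _))) ?padic_abs_ge0//
      -ltr_pdivlMl// mulrC vN.
  by rewrite (le_lt_trans (ler_wpM2l _ (vK _))) ?padic_abs_ge0//
    -ltr_pdivlMr// uN.
Qed.

HB.instance Definition _ :=
  GRing.isSubringClosed.Build _ (padic_cauchy R p) padic_cauchy_subring.

HB.instance Definition _ :=
  [SubChoice_isSubComNzRing of cauchy_seq R p by <:].

Lemma cauchy_seqB (u v : cauchy_seq R p) n : (u - v) n = u n - v n.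
Proof. by []. Qed.

Lemma cauchy_seqD (u v : cauchy_seq R p) n : (u + v) n = u n + v n.
Proof. by []. Qed.

Lemma cauchy_seqN (u : cauchy_seq R p) n : (- u) n = - u n.
Proof. by []. Qed.

Lemma cauchy_seqM (u v : cauchy_seq R p) n : (u * v) n = u n * v n.
Proof. by []. Qed.

Lemma cauchy_seq1 n : (1 : cauchy_seq R p) n = 1.
Proof. by []. Qed.

Definition cauchy_null : pred (cauchy_seq R p) := fun u =>
  `[< forall e : R, 0 < e ->
      exists N, forall n, (N <= n)%N -> abs (u n) < e >].

Lemma cauchy_nullP (u : cauchy_seq R p) :
  reflect (forall e : R, 0 < e ->
    exists N, forall n, (N <= n)%N -> abs (u n) < e)
  (u \in cauchy_null).
Proof. exact: asboolP. Qed.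

Lemma cauchy_null_ideal : idealr_closed cauchy_null.
Proof.
split.
- by apply/cauchy_nullP => e e0; exists 0 => n _; rewrite padic_abs0.
- apply/cauchy_nullP => /(_ 1 ltr01) [N /(_ N (leqnn N))].
  by rewrite padic_abs1 ltxx.
- move=> a u v /cauchy_nullP nu /cauchy_nullP nv.
  have [M M0 aM] := padic_cauchy_bounded (cauchy_seq_valP a).
  apply/cauchy_nullP => e e0.
  have [N1 uN] := nu _ (divr_gt0 e0 M0); have [N2 vN] := nv _ e0.
  exists (maxn N1 N2) => n; rewrite geq_max => /andP[n1 n2].
  rewrite cauchy_seqD cauchy_seqM.
  rewrite (le_lt_trans (padic_absD _ _ _ _))// gt_max vN// andbT padic_absM.
  by rewrite (le_lt_trans (ler_wpM2r _ (aM _))) ?padic_abs_ge0//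
    -ltr_pdivlMl// mulrC uN.
Qed.

HB.instance Definition _ := isIdealr.Build _ cauchy_null cauchy_null_ideal.

Lemma cauchy_not_null (u : cauchy_seq R p) : u \notin cauchy_null ->
  exists2 c : R, 0 < c & exists N, forall n, (N <= n)%N -> c <= abs (u n).
Proof.
move=> /cauchy_nullP; rewrite -existsNP => -[e].
rewrite not_implyP => -[e0 /forallNP nu].
exists e => //.
have /padic_cauchyP/(_ _ e0)[N uN] := cauchy_seq_valP u.
exists N => n Nn.
have := nu N; rewrite -existsNP => -[m].
rewrite not_implyP => -[Nm /negP]; rewrite -leNgt => eum.
rewrite leNgt; apply/negP => une.
have : abs (u m) < e.
  rewrite -[u m](subrK (u n)) (le_lt_trans (padic_absD _ _ _ _))//.
  by rewrite gt_max uN.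
by rewrite ltNge eum.
Qed.

End CauchySeq.

(* The completion of rat for the metric padic_abs R p (x - y): Cauchy sequences
   modulo null sequences.  The parameter R only provides the real numbers in
   which absolute values are taken. *)
Definition Qp (R : realType) (p : prime_number) :=
  {ideal_quot (@cauchy_null R p : idealr (cauchy_seq R p))}.

HB.instance Definition _ R p := GRing.ComNzRing.on (Qp R p).

Section QpTheory.
Variables (R : realType) (p : prime_number).
Local Notation abs := (padic_abs R p).
Local Notation Qp := (Qp R p).
Implicit Types (x y z : Qp) (u v : cauchy_seq R p).

Definition Qp_class u : Qp := (\pi_Qp u)%qT.

Definition Qp_repr x : cauchy_seq R p := repr x.

Lemma Qp_reprK : cancel Qp_repr Qp_class.
Proof. exact: reprK. Qed.

Lemma Qp_classP u v :
  reflect (Qp_class u = Qp_class v) (u - v \in @cauchy_null R p).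
Proof.
rewrite -Quotient.equivE; apply: (iffP idP) => [uv|/eqP].
  by apply/eqP; rewrite /Qp_class piE.
by rewrite /Qp_class piE.
Qed.

Lemma Qp_class0 : Qp_class 0 = 0.
Proof. exact: rmorph0. Qed.

Lemma Qp_class1 : Qp_class 1 = 1.
Proof. exact: rmorph1. Qed.

Lemma Qp_classD u v : Qp_class (u + v) = Qp_class u + Qp_class v.
Proof. exact: rmorphD. Qed.

Lemma Qp_classN u : Qp_class (- u) = - Qp_class u.
Proof. exact: rmorphN. Qed.

Lemma Qp_classM u v : Qp_class (u * v) = Qp_class u * Qp_class v.
Proof. exact: rmorphM. Qed.

Lemma cauchy_seqV u : u \notin @cauchy_null R p ->
  (fun n => (u n)^-1) \in padic_cauchy R p.
Proof.
move=> /cauchy_not_null[c c0 [N uN]]; apply/padic_cauchyP => e e0.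
have /padic_cauchyP/(_ _ (mulr_gt0 e0 (mulr_gt0 c0 c0)))[M uM] :=
  cauchy_seq_valP u.
exists (maxn M N) => m n; rewrite !geq_max => /andP[Mm Nm] /andP[Mn Nn].
have um0 : u m != 0 by rewrite -(padic_abs_gt0 R p) (lt_le_trans c0)// uN.
have un0 : u n != 0 by rewrite -(padic_abs_gt0 R p) (lt_le_trans c0)// uN.
have -> : (u m)^-1 - (u n)^-1 = (u n - u m) / (u m * u n).
  by rewrite mulrBl invfM mulrCA mulfV// mulr1 mulrA mulfV// mul1r.
rewrite padic_absM padic_absV padic_absM ltr_pdivrMr; last first.
  by rewrite mulr_gt0// padic_abs_gt0.
rewrite (lt_le_trans (uM _ _ Mn Mm))// ler_pM2l// ler_pM ?(ltW c0) ?uN//.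
Qed.

Lemma Qp_has_inv x : x != 0 -> exists y, y * x = 1.
Proof.
rewrite -[x]Qp_reprK => x0; set u := Qp_repr x.
have nu : u \notin @cauchy_null R p.
  apply: contra x0 => nu; apply/eqP; rewrite -Qp_class0; apply/Qp_classP.
  by rewrite subr0.
exists (Qp_class (CauchySeq (cauchy_seqV nu))).
rewrite -Qp_classM -Qp_class1; apply/Qp_classP/cauchy_nullP => e e0.
have [c c0 [N uN]] := cauchy_not_null nu; exists N => n Nn.
rewrite cauchy_seqB cauchy_seqM cauchy_seq1 /= mulVf ?subrr ?padic_abs0//.
by rewrite -(padic_abs_gt0 R p) (lt_le_trans c0)// uN.
Qed.

Definition Qp_inv x : Qp := if x == 0 then 0 else xget 0 [set y | y * x = 1].

Lemma Qp_mulVf x : x != 0 -> Qp_inv x * x = 1.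
Proof.
move=> x0; rewrite /Qp_inv (negPf x0).
by have [y yx] := Qp_has_inv x0; exact: (@xgetPex _ 0 [set y | y * x = 1] (ex_intro _ y yx)).
Qed.

Lemma Qp_inv0 : Qp_inv 0 = 0.
Proof. by rewrite /Qp_inv eqxx. Qed.

HB.instance Definition _ := GRing.ComNzRing_isField.Build Qp Qp_mulVf Qp_inv0.

Lemma cvg_cauchy_seq_abs u : cvgn (fun n => abs (u n)).
Proof.
apply/cauchy_cvgP/cauchy_exP => e e0.
have /padic_cauchyP/(_ _ e0)[N uN] := cauchy_seq_valP u.
exists (abs (u N)); exists N => // n /= Nn.
by rewrite /ball/= (le_lt_trans (padic_abs_dist _ _ _ _))// uN.
Qed.

Arguments cvg_cauchy_seq_abs : clear implicits.

Definition Qp_norm x : R := limn (fun n => abs (Qp_repr x n)).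

Lemma Qp_norm_class u : Qp_norm (Qp_class u) = limn (fun n => abs (u n)).
Proof.
set v := Qp_repr (Qp_class u).
have /cauchy_nullP uv : u - v \in @cauchy_null R p.
  by apply/Qp_classP; rewrite Qp_reprK.
apply/esym/cvg_lim => //; rewrite /Qp_norm -/v.
apply: cvg_sub0 (cvg_cauchy_seq_abs v).
apply/cvgrPdist_lt => e /uv[N uvN]; exists N => // n /= Nn.
rewrite sub0r normrN !fctE (le_lt_trans (padic_abs_dist _ _ _ _))//.
exact: uvN.
Qed.

Lemma Qp_norm_class_le u (c : R) :
  (\forall n \near \oo, abs (u n) <= c) -> Qp_norm (Qp_class u) <= c.
Proof.
by move=> uc; rewrite Qp_norm_class limr_le//; exact: cvg_cauchy_seq_abs.
Qed.

Lemma Qp_norm_ge0 x : 0 <= Qp_norm x.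
Proof.
apply: limr_ge; first exact: cvg_cauchy_seq_abs.
by near=> n; exact: padic_abs_ge0.
Unshelve. all: by end_near. Qed.

Lemma Qp_norm_eq0 x : Qp_norm x = 0 -> x = 0.
Proof.
move=> x0; rewrite -[x]Qp_reprK -Qp_class0; apply/Qp_classP.
rewrite subr0; apply/cauchy_nullP => e e0.
have := cvg_cauchy_seq_abs (Qp_repr x).
rewrite -/(Qp_norm x) x0 => /cvgrPdist_lt/(_ _ e0)[N _ xN].
exists N => n /xN; rewrite /= sub0r normrN ger0_norm//; exact: padic_abs_ge0.
Qed.

Lemma Qp_norm0 : Qp_norm 0 = 0.
Proof.
apply/le_anti; rewrite Qp_norm_ge0 andbT -Qp_class0.
by apply: Qp_norm_class_le; near=> n; rewrite padic_abs0.
Unshelve. all: by end_near. Qed.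

Lemma Qp_normN x : Qp_norm (- x) = Qp_norm x.
Proof.
rewrite -[x]Qp_reprK -Qp_classN !Qp_norm_class; congr (limn _).
by apply/funext => n; rewrite cauchy_seqN padic_absN.
Qed.

Lemma Qp_normM x y : Qp_norm (x * y) = Qp_norm x * Qp_norm y.
Proof.
rewrite -[x]Qp_reprK -[y]Qp_reprK -Qp_classM !Qp_norm_class.
rewrite -limM//; [|exact: cvg_cauchy_seq_abs..].
by congr (limn _); apply/funext => n; rewrite cauchy_seqM padic_absM.
Qed.

Lemma Qp_normD x y : Qp_norm (x + y) <= Num.max (Qp_norm x) (Qp_norm y).
Proof.
rewrite leNgt; apply/negP; rewrite gt_max => /andP[].
rewrite -[x]Qp_reprK -[y]Qp_reprK -Qp_classD !Qp_norm_class.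
set u := Qp_repr x; set v := Qp_repr y => ux vx.
have cu := cvg_cauchy_seq_abs u; have cv := cvg_cauchy_seq_abs v.
have cuv := cvg_cauchy_seq_abs (u + v).
have [d /andP[d1 d2]] : exists d, Num.max (limn (fun n => abs (u n)))
    (limn (fun n => abs (v n))) < d < limn (fun n => abs ((u + v) n)).
  set a := Num.max _ _; set b := limn _.
  have /midf_lt[ac cb] : a < b by rewrite gt_max ux.
  by exists ((a + b) / 2); rewrite ac.
move: d1; rewrite gt_max => /andP[ud vd].
move: d2; apply/negP; rewrite -leNgt.
apply: limr_le => //; near=> n.
rewrite (le_trans (padic_absD _ _ _ _))// ge_max; apply/andP; split.
- by near: n; apply: (cvgr_le _ cu).
- by near: n; apply: (cvgr_le _ cv).
Unshelve. all: by end_near. Qed.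

Lemma Qp_norm_triangle x y : Qp_norm (x + y) <= Qp_norm x + Qp_norm y.
Proof.
by rewrite (le_trans (Qp_normD _ _))// ge_max lerDl lerDr !Qp_norm_ge0.
Qed.

Definition Qp_dist x y : R := Qp_norm (x - y).

Lemma Qp_distxx x : Qp_dist x x = 0.
Proof. by rewrite /Qp_dist subrr Qp_norm0. Qed.

Lemma Qp_dist_eq x y : Qp_dist x y = 0 -> x = y.
Proof. by move/Qp_norm_eq0/eqP; rewrite subr_eq0 => /eqP. Qed.

Lemma Qp_distC x y : Qp_dist x y = Qp_dist y x.
Proof. by rewrite /Qp_dist -Qp_normN opprB. Qed.

Lemma Qp_dist_triangle y x z : Qp_dist x z <= Qp_dist x y + Qp_dist y z.
Proof. by rewrite /Qp_dist -{1}[x](subrK y) -addrA Qp_norm_triangle. Qed.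

(* Qp_norm is not a norm in the sense of normedZmodType, which requires
   `|x *+ n| = `|x| *+ n; hence only the metric structure is declared. *)
HB.instance Definition _ := @isMetric.Build R Qp
  Qp_dist Qp_distxx Qp_dist_eq Qp_distC Qp_dist_triangle.

HB.instance Definition _ := isPointed.Build Qp 0.

Lemma cst_cauchy (q : rat) : (fun=> q) \in padic_cauchy R p.
Proof.
by apply/padic_cauchyP => e e0; exists 0 => m n _ _; rewrite subrr padic_abs0.
Qed.

Lemma Qp_class_cst (q : rat) : Qp_class (CauchySeq (cst_cauchy q)) = ratr q.
Proof.
pose f (q : rat) := Qp_class (CauchySeq (cst_cauchy q)).
have fB : zmod_morphism f.
  move=> a b; rewrite /f -Qp_classN -Qp_classD; congr Qp_class.
  by apply/val_inj/funext => n.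
have fM : monoid_morphism f.
  split; first by rewrite -Qp_class1; congr Qp_class; by apply/val_inj/funext => n.
  move=> a b; rewrite /f -Qp_classM; congr Qp_class.
  by apply/val_inj/funext => n.
pose fZ := GRing.isZmodMorphism.Build _ _ f fB.
pose fR := GRing.isMonoidMorphism.Build _ _ f fM.
pose F : {rmorphism rat -> Qp} := HB.pack f fZ fR.
exact: (fmorph_eq_rat F).
Qed.

Lemma Qp_ratrB (a b : rat) : ratr (a - b) = ratr a - ratr b :> Qp.
Proof.
rewrite -!Qp_class_cst -Qp_classN -Qp_classD; congr Qp_class.
by apply/val_inj/funext => n.
Qed.

Lemma Qp_norm_rat (q : rat) : Qp_norm (ratr q) = abs q.
Proof. rewrite -Qp_class_cst Qp_norm_class; apply: cvg_lim => //; exact: (@cvg_cst _ (abs q)). Qed.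

Lemma Qp_rat_dense x (e : R) : 0 < e -> exists q, Qp_norm (x - ratr q) < e.
Proof.
move=> e0; set u := Qp_repr x.
have /padic_cauchyP/(_ _ (divr_gt0 e0 (ltr0Sn R 1)))[N uN] := cauchy_seq_valP u.
exists (u N); rewrite -[x]Qp_reprK -/u -Qp_class_cst -Qp_classN -Qp_classD.
rewrite (@le_lt_trans _ _ (e / 2))//; last by rewrite ltr_pdivrMr// ltr_pMr// ltr1n.
by apply: Qp_norm_class_le; exists N => // n /= Nn; rewrite ltW// uN.
Qed.

Lemma Qp_complete (F : set_system Qp) : ProperFilter F -> cauchy F -> cvg F.
Proof.
move=> FF /cauchyP Fc.
have /choice[q qF] (n : nat) : exists q : rat,
    F [set y | Qp_norm (ratr q - y) < n.+1%:R^-1].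
  have n0 : (0 : R) < n.+1%:R^-1 by rewrite invr_gt0.
  have [x Fx] := Fc _ n0.
  have [q xq] := Qp_rat_dense x n0; exists q.
  apply: filterS Fx => y /=; rewrite /ball/= /Qp_dist => xy.
  rewrite (_ : _ - _ = (x - y) - (x - ratr q)); last first.
    by rewrite opprB [RHS]addrC addrA subrK.
  by rewrite (le_lt_trans (Qp_normD _ _))// Qp_normN gt_max xy.
have small (e : R) : 0 < e -> exists N, forall n, (N <= n)%N -> n.+1%:R^-1 < e.
  move=> e0; have [N _ eN] := near_infty_natSinv_lt (PosNum e0).
  by exists N => n /eN.
have qc : q \in padic_cauchy R p.
  apply/padic_cauchyP => e /small[N Ne]; exists N => m n Nm Nn.
  have [y [/= my ny]] := filter_ex (filterI (qF m) (qF n)).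
  rewrite -Qp_norm_rat Qp_ratrB.
  rewrite (_ : _ - _ = (ratr (q m) - y) - (ratr (q n) - y)); last first.
    by rewrite opprB addrA subrK.
  rewrite (le_lt_trans (Qp_normD _ _))// Qp_normN gt_max.
  by rewrite (lt_trans my) ?Ne// (lt_trans ny) ?Ne.
set l := Qp_class (CauchySeq qc).
apply/cvg_ex; exists l; apply/metricType_numDomainType.fcvgrPdist_lt => e e0.
have [N Ne] := small _ e0.
have /padic_cauchyP/(_ _ (divr_gt0 e0 (ltr0Sn R 1)))[M qM] := qc.
apply: filterS (qF (maxn M N)) => y /= qy.
rewrite /mdist/= /Qp_dist.
rewrite (_ : l - y = (l - ratr (q (maxn M N))) + (ratr (q (maxn M N)) - y)); last first.
  by rewrite addrA subrK.
rewrite (le_lt_trans (Qp_normD _ _))// gt_max; apply/andP; split; last first.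
  by rewrite (lt_trans qy)// Ne// leq_maxr.
rewrite -Qp_class_cst -Qp_classN -Qp_classD.
rewrite (@le_lt_trans _ _ (e / 2))//; last by rewrite ltr_pdivrMr// ltr_pMr// ltr1n.
apply: Qp_norm_class_le; exists M => // n /= Mn.
by rewrite ltW// qM// leq_maxl.
Qed.

HB.instance Definition _ := Uniform_isComplete.Build Qp Qp_complete.

End QpTheory.

(* Meant for Qp_norm z <= 1, where the series converges. *)
Definition euler_factorial_series (R : realType) (p : prime_number)
    (z : Qp R p) : Qp R p :=
  limn [series n`!%:R * z ^+ n]_n.

(* In the next two definitions, \big[op/idx]_(p \in U) is the finitely supported
   product over a possibly infinite set; its value would be 1 if infinitely many
   factors were different from 1, which does not occur for xi != 0. *)
Definition euler_const (R : realType) (xi : int) (U : set prime_number) : R :=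
  4 * `|xi|%:~R * \big[*%R/1]_(p \in U) padic_abs R p xi%:~R ^+ 2.

Definition fact_padic_prod (R : realType) (U : set prime_number) (n : nat) : R :=
  \big[*%R/1]_(p \in U) padic_abs R p n`!%:R ^+ 2.

(* Main.v *)
(* Let Q_n, P_n be the diagonal Pade approximants of F(z) = sum n! z^n:
   Q_n(z) F(z) - P_n(z) = sum_(m >= n) n! m! C(m,n) z^(n+m), with Q_n and P_n
   satisfying w_(n+2) = (1 - (2n+3) z) w_(n+1) - ((n+1) z)^2 w_n.  The integer
   D_n = a Q_n(xi) - b P_n(xi) satisfies the same recurrence, so it has size
   O((4|xi|)^n n!), and D_n = D_(n+1) = 0 would descend to a = b = 0.  If
   a = b F_p(xi), then D_n = b (Q_n F - P_n)(xi) is p-adically divisible by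
   (n! xi^n)^2.  If only finitely many p in T (those in S) satisfied
   a <> b F_p(xi), then for every D_n <> 0 the product formula would bound
   c^n n! prod_(p in T \ S) |n!|_p^2 below by 1 / (|a| + |b|).

   Convergence of power series is avoided: pade_form_congr compares D_n with
   the truncated remainder modulo any common divisor of N! and of b F_N - a,
   where F_N is the N-th partial sum of F(xi). *)

Require Import Defs.
From mathcomp Require Import all_boot all_order all_algebra.
From mathcomp Require Import all_classical all_reals all_analysis.
From mathcomp Require Import ring zify.

Set Implicit Arguments.
Unset Strict Implicit.
Unset Printing Implicit Defensive.

Import Order.TTheory GRing.Theory Num.Theory.
Import numFieldNormedType.Exports.

Local Open Scope classical_set_scope.
Local Open Scope ring_scope.

(** * Coefficients and truncations of the Pade remainders *)

Definition pade_coef (n m : nat) : nat := (n`! * m`! * 'C(m, n))%N.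

(** Divided by [(n+1) n! m!], this is the sum of the instances [k = n+1] and [k = n] of
    [(m+1) C(m,k) = (k+1) C(m+1,k+1)], expanded by Pascal's rule. *)
Lemma pade_coef_rec n m :
  (pade_coef n.+1 m.+1 = pade_coef n.+2 m + (2 * n + 3) * pade_coef n.+1 m
                         + n.+1 ^ 2 * pade_coef n m)%N.
Proof.
have e1 := mul_bin_diag m.+1 n.+1; have e2 := mul_bin_diag m.+1 n.
rewrite !binS /= in e1 e2.
rewrite /pade_coef !factS binS.
have {e1 e2} e : (m.+1 * ('C(m, n.+1) + 'C(m, n)) = n.+2 * 'C(m, n.+2)
    + (2 * n + 3) * 'C(m, n.+1) + n.+1 * 'C(m, n))%N by lia.
transitivity (n.+1 * n`! * m`! * (m.+1 * ('C(m, n.+1) + 'C(m, n))))%N; first by ring.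
rewrite e; ring.
Qed.

Definition pade_rem (x : int) (n N : nat) : int :=
  \sum_(m < N) (pade_coef n m)%:Z * x ^+ (n + m).

Lemma pade_remS x n N :
  pade_rem x n N.+1 = pade_rem x n N + (pade_coef n N)%:Z * x ^+ (n + N).
Proof. by rewrite /pade_rem big_ord_recr. Qed.

Lemma pade_rem0E x N : pade_rem x 0 N = \sum_(m < N) m`!%:Z * x ^+ m.
Proof.
by apply: eq_bigr => m _; rewrite /pade_coef bin0 muln1 mul1n.
Qed.

Lemma pade_rem1 x N : pade_rem x 1 N = pade_rem x 0 N.+1 - 1 - x * pade_rem x 0 N.
Proof.
rewrite /pade_rem big_ord_recl /= mulr_sumr.
have -> : (pade_coef 0 0)%:Z * x ^+ (0 + 0) = 1 by [].
rewrite [1 + _ - 1]addrAC subrr add0r -sumrB; apply: eq_bigr => m _.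
rewrite /bump /= /pade_coef !bin0 bin1 !fact0 factS !add1n !add0n muln1 !mul1n.
rewrite !PoszM -[m.+1]addn1 PoszD exprD expr1; ring.
Qed.

(** The coefficient identity pairs index [m+1] with [m], so the middle remainder carries one more
    term; its term at [m = 0] vanishes because [C(0,n+1) = 0]. *)
Lemma pade_rem_rec x n N : pade_rem x n.+2 N = pade_rem x n.+1 N.+1
  - (2 * n + 3)%:R * x * pade_rem x n.+1 N - (n.+1%:R * x) ^+ 2 * pade_rem x n N.
Proof.
rewrite /pade_rem big_ord_recl.
have -> : (pade_coef n.+1 0)%:Z * x ^+ (n.+1 + 0) = 0.
  by rewrite /pade_coef bin0n muln0 mul0r.
rewrite add0r !mulr_sumr -!sumrB; apply: eq_bigr => m _.
rewrite lift0 addnS !addSn !exprS; set e := x ^+ _.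
have -> : (pade_coef n.+1 m.+1)%:Z = (pade_coef n.+2 m)%:Z
    + (2 * n + 3)%:R * (pade_coef n.+1 m)%:Z + n.+1%:R ^+ 2 * (pade_coef n m)%:Z.
  by rewrite pade_coef_rec !natz expr2 -mulnn !PoszD !PoszM.
ring.
Qed.

Lemma dvdz_fact_pade_coef n N : (N`!%:Z %| (pade_coef n N)%:Z)%Z.
Proof. by rewrite dvdzE /= /pade_coef mulnAC dvdn_mull. Qed.

(** Terms with [m < n] vanish with [C(m,n)]; in the others [n!] divides [m!] and [n + m >= 2n]. *)
Lemma dvdz_pade_rem x n N : ((n`!%:Z * x ^+ n) ^+ 2 %| pade_rem x n N)%Z.
Proof.
apply: rpred_sum => m _.
have [mn|nm] := ltnP m n; first by rewrite /pade_coef bin_small // muln0 mul0r dvdz0.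
rewrite exprMn -exprM muln2 -addnn dvdz_mul ?dvdz_exp2l ?leq_add2l //.
rewrite expr2 -PoszM dvdzE /= /pade_coef -mulnA dvdn_mul // dvdn_mulr //.
by rewrite -(bin_fact nm) dvdn_mull // dvdn_mulr.
Qed.

(** * The integer linear form: congruences, growth, non-vanishing *)

(* The value a Q_n(x) - b P_n(x). *)
Fixpoint pade_form (a b x : int) (n : nat) : int :=
  match n with
  | 0%N => a
  | k.+1 => match k with
    | 0%N => a * (1 - x) - b
    | m.+1 => (1 - (2 * m + 3)%:R * x) * pade_form a b x k
              - (m.+1%:R * x) ^+ 2 * pade_form a b x m
    end
  end.

Lemma pade_formSS a b x n : pade_form a b x n.+2 =
  (1 - (2 * n + 3)%:R * x) * pade_form a b x n.+1
  - (n.+1%:R * x) ^+ 2 * pade_form a b x n.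
Proof. by []. Qed.

(** Both sequences obey the same recurrence up to the term of index [N], a multiple of [N!] and
    hence of [d]; the hypothesis on [b F_N - a] starts the induction. *)
Lemma pade_form_congr a b x d N n : (d %| N`!%:Z)%Z ->
  (d %| b * pade_rem x 0 N - a)%Z ->
  (d %| pade_form a b x n - b * pade_rem x n N)%Z.
Proof.
move=> dN dE.
have dC k : (d %| (pade_coef k N)%:Z * x ^+ (k + N))%Z.
  by rewrite dvdz_mulr // (dvdz_trans dN) // dvdz_fact_pade_coef.
have dSS k : (d %| pade_form a b x k - b * pade_rem x k N)%Z ->
  (d %| pade_form a b x k.+1 - b * pade_rem x k.+1 N)%Z ->
  (d %| pade_form a b x k.+2 - b * pade_rem x k.+2 N)%Z.
  move=> d0 d1; rewrite pade_formSS pade_rem_rec pade_remS.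
  set t := _ * x ^+ _; have dt : (d %| t)%Z by exact: dC.
  rewrite (_ : _ - _ = (1 - (2 * k + 3)%:R * x) *
       (pade_form a b x k.+1 - b * pade_rem x k.+1 N)
     - (k.+1%:R * x) ^+ 2 * (pade_form a b x k - b * pade_rem x k N) - b * t);
    last by ring.
  by rewrite !rpredB // dvdz_mull.
suff [] : (d %| pade_form a b x n - b * pade_rem x n N)%Z /\
  (d %| pade_form a b x n.+1 - b * pade_rem x n.+1 N)%Z by [].
elim: n => [|n [IH0 IH1]]; last by split; [exact: IH1|exact: dSS].
rewrite /= pade_rem1 pade_remS; split; first by rewrite -opprB rpredN.
set t := _ * x ^+ _; have dt : (d %| t)%Z by exact: dC.
rewrite (_ : _ - _ = - (1 - x) * (b * pade_rem x 0 N - a) - b * t); last by ring.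
by rewrite rpredB // dvdz_mull.
Qed.

(** As [|x| >= 1], the recurrence coefficients are at most [(2n+4)|x|] and [((n+1)|x|)^2], and
    [4(2n+4) + (n+1) <= 16(n+2)] closes the induction. *)
Lemma pade_form_le a b x n : x != 0 ->
  `|pade_form a b x n| <= (`|a| + `|b|) * (4 * `|x|) ^+ n * n`!%:R.
Proof.
move=> x0; have x1 : 1 <= `|x| by rewrite -gtz0_ge1 normr_gt0.
set C := `|a| + `|b|; set y := `|x| in x1 *.
have y0 : 0 <= y by rewrite (le_trans _ x1).
have C0 : 0 <= C by rewrite addr_ge0.
suff [] : `|pade_form a b x n| <= C * (4 * y) ^+ n * n`!%:R /\
  `|pade_form a b x n.+1| <= C * (4 * y) ^+ n.+1 * n.+1`!%:R by [].
elim: n => [|n [IH0 IH1]].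
  rewrite /= !mulr1 expr1; split; first by rewrite lerDl.
  rewrite (le_trans (ler_normB _ _)) // normrM.
  have : `|1 - x| <= 1 + y by rewrite (le_trans (ler_normB _ _)) ?normr1.
  move/(ler_wpM2l (normr_ge0 a)) => h.
  have := ler_wpM2l (normr_ge0 a) x1; have := ler_wpM2l (normr_ge0 b) x1.
  have := normr_ge0 a; have := normr_ge0 b; rewrite /C; lia.
split=> //; rewrite pade_formSS (le_trans (ler_normB _ _)) //.
rewrite !(normrM _ (pade_form _ _ _ _)).
have h1 : `|1 - (2 * n + 3)%:R * x| <= (2 * n + 4)%:R * y.
  rewrite (le_trans (ler_normB _ _)) // normr1 normrM normr_nat.
  have -> : (2 * n + 4)%:R = 1 + (2 * n + 3)%:R :> int.
    by rewrite nat1r; congr _%:R; lia.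
  by rewrite mulrDl mul1r lerD2r.
have -> : `|(n.+1%:R * x) ^+ 2| = (n.+1%:R * y) ^+ 2.
  by rewrite normrX normrM normr_nat.
have h2 := ler_pM (normr_ge0 _) (normr_ge0 _) h1 IH1.
have h3 := ler_wpM2l (sqr_ge0 (n.+1%:R * y)) IH0.
apply: (le_trans (lerD h2 h3)).
rewrite !exprS !factS !natrM.
set P := (4 * y) ^+ n; set f := (n`!%:R : int).
have t0 : 0 <= C * P * y ^+ 2 * f * n.+1%:R.
  by rewrite !mulr_ge0 ?exprn_ge0 ?mulr_ge0 ?ler0n.
rewrite -subr_ge0.
(* [7(n+1) + 8] is the slack [16(n+2) - 4(2n+4) - (n+1)] left once the common factor is taken
   out. *)
rewrite [leRHS](_ : _ = C * P * y ^+ 2 * f * n.+1%:R * (7 * n.+1%:R + 8)).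
  by rewrite mulr_ge0 // addr_ge0 // mulr_ge0 ?ler0n.
rewrite natrD natrM -[n.+2]addn1 -[n.+1]addn1 !natrD; ring.
Qed.

(** Since [((n+1) x)^2] is nonzero, two consecutive zeros propagate down to indices 0 and 1, where
    they force [a = 0] and then [b = 0]. *)
Lemma pade_form_neq0 a b x n : x != 0 -> b != 0 ->
  (pade_form a b x n != 0) || (pade_form a b x n.+1 != 0).
Proof.
move=> x0 b0; rewrite -negb_and; apply/negP; elim: n => [|n IH].
  case/andP => /eqP /= -> /eqP; rewrite mul0r sub0r => /eqP.
  by rewrite oppr_eq0 (negPf b0).
case/andP => e1 /eqP; rewrite pade_formSS (eqP e1) mulr0 sub0r => /eqP.
rewrite oppr_eq0 mulf_eq0 expf_eq0 mulf_eq0 (negPf x0) orbF pnatr_eq0 /= => e0.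
by apply: IH; rewrite e1 e0.
Qed.

(** Each extra term has an index [j >= N], and [j!] divides its coefficient. *)
Lemma dvdz_pade_remB x n N m : (N <= m)%N ->
  (N`!%:Z %| pade_rem x n m - pade_rem x n N)%Z.
Proof.
move=> /subnK <-; elim: (m - N)%N => [|k IH]; first by rewrite add0n subrr dvdz0.
rewrite addSn pade_remS addrAC rpredD // dvdz_mulr //.
rewrite (dvdz_trans _ (dvdz_fact_pade_coef n _)) //.
by rewrite dvdzE /= -(bin_fact (leq_addl k N)) dvdn_mull // dvdn_mulr //.
Qed.

(** * Divisibility by prime powers and the value of the series *)

Section PadicDivisibility.
Variables (R : realType) (p : prime_number).
Let p_pr : prime p := prime_valP p.

Lemma padic_abs_intE (z : int) : z != 0 ->
  padic_abs R p z%:~R = (p%:R ^+ logn p `|z|)^-1.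
Proof.
move=> z0; rewrite padic_abs_neq0 ?intr_eq0 // -[z%:~R]divr1.
by rewrite (_ : 1 = 1%:~R) // padic_val_frac // logn1 subr0 -invr_expz -exprnP.
Qed.

Lemma padic_absX (z : rat) k : padic_abs R p (z ^+ k) = padic_abs R p z ^+ k.
Proof. by elim: k => [|k IH]; rewrite ?expr0 ?padic_abs1 // !exprS padic_absM IH. Qed.

Lemma padic_abs_int_le (z : int) k :
  (padic_abs R p z%:~R <= (p%:R ^+ k)^-1) = ((p ^ k)%N%:Z %| z)%Z.
Proof.
have p0 : 0 < p%:R :> R by rewrite ltr0n prime_gt0.
have [->|z0] := eqVneq z 0; first by rewrite padic_abs0 dvdz0 invr_ge0 exprn_ge0 // ltW.
rewrite padic_abs_intE // lef_pV2 ?posrE ?exprn_gt0 // ler_eXn2l ?ltr1n ?prime_gt1 //.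
by rewrite dvdzE /= pfactor_dvdn // absz_gt0.
Qed.

Lemma padic_expV_small (e : R) : 0 < e -> exists k, (p%:R ^+ k)^-1 < e.
Proof.
move=> e0; have [k _ ke] := near_infty_natSinv_lt (PosNum e0).
exists k; apply: le_lt_trans (ke k (leqnn k)).
have pk0 : 0 < p%:R ^+ k :> R by rewrite exprn_gt0 // ltr0n prime_gt0.
rewrite lef_pV2 ?posrE //.
by rewrite -natrX ler_nat ltn_expl // prime_gt1.
Qed.

Variable x : int.

Lemma pade_rem_cauchy : (fun N => (pade_rem x 0 N)%:~R) \in padic_cauchy R p.
Proof.
(* The cutoff [p^k] works because [p^k] divides [(p^k)!], which divides every difference of later
   partial sums. *)
apply/padic_cauchyP => e /padic_expV_small[k ke]; exists (p ^ k)%N => m n km kn.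
apply: le_lt_trans ke; rewrite -rmorphB padic_abs_int_le.
have dk : ((p ^ k)%N%:Z %| (p ^ k)`!%:Z)%Z.
  by rewrite dvdzE /= dvdn_fact // expn_gt0 prime_gt0 /=.
rewrite (_ : _ - _ = (pade_rem x 0 m - pade_rem x 0 (p ^ k)) -
  (pade_rem x 0 n - pade_rem x 0 (p ^ k))); last by ring.
by rewrite rpredB // (dvdz_trans dk) // dvdz_pade_remB.
Qed.

(** Replaces the limit by an explicit Cauchy class, so that relations in [Qp] become statements
    about integer partial sums. *)
Lemma euler_factorial_series_int :
  euler_factorial_series (x%:~R : Qp R p) = Qp_class (CauchySeq pade_rem_cauchy).
Proof.
rewrite /euler_factorial_series; set l := Qp_class _.
apply: cvg_lim; first exact: metric_hausdorff.
apply/metricType_numDomainType.cvgrPdist_lt => e e0.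
(* Halving turns the non-strict bound of [Qp_norm_class_le] into a strict one. *)
have e20 : 0 < e / 2 by rewrite divr_gt0.
have /padic_cauchyP/(_ _ e20)[M uM] := pade_rem_cauchy.
exists M => // N /= MN; rewrite /mdist /= /Qp_dist.
have -> : [series n`!%:R * (x%:~R : Qp R p) ^+ n]_n N = ratr (pade_rem x 0 N)%:~R.
  rewrite /series /= big_mkord ratr_int pade_rem0E rmorph_sum /=.
  by apply: eq_bigr => i _; rewrite rmorphM rmorphXn.
rewrite -Qp_class_cst -Qp_classN -Qp_classD.
apply: (@le_lt_trans _ _ (e / 2)); last by rewrite ltr_pdivrMr // ltr_pMr // ltr1n.
by apply: Qp_norm_class_le; exists M => // n /= Mn; rewrite ltW // uM.
Qed.

(** Equality of classes makes [b F_N - a] a null sequence, and for integers a small absolute value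
    is divisibility by a power of [p]. *)
Lemma euler_relation_dvdz (a b : int) k :
  a%:~R - b%:~R * euler_factorial_series (x%:~R : Qp R p) = 0 ->
  exists N0, forall N, (N0 <= N)%N -> ((p ^ k)%N%:Z %| b * pade_rem x 0 N - a)%Z.
Proof.
rewrite euler_factorial_series_int; set u := CauchySeq _.
pose c z := CauchySeq (cst_cauchy R p z%:~R).
have cE z : z%:~R = Qp_class (c z) by rewrite Qp_class_cst ratr_int.
move/eqP; rewrite subr_eq0 => /eqP e; move: e.
rewrite !cE -Qp_classM => /esym/Qp_classP/cauchy_nullP.
have pk0 : 0 < (p%:R ^+ k)^-1 :> R by rewrite invr_gt0 exprn_gt0 // ltr0n prime_gt0.
move=> /(_ _ pk0)[N0 h]; exists N0 => N /h.
rewrite cauchy_seqB cauchy_seqM /= -rmorphM -rmorphB => /ltW.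
by rewrite padic_abs_int_le.
Qed.

Lemma pade_form_pfactor_dvdz (a b : int) n k :
  a%:~R - b%:~R * euler_factorial_series (x%:~R : Qp R p) = 0 ->
  ((p ^ k)%N%:Z %| (n`!%:Z * x ^+ n) ^+ 2)%Z ->
  ((p ^ k)%N%:Z %| pade_form a b x n)%Z.
Proof.
move=> /(euler_relation_dvdz k)[N0 hN] dk.
(* This truncation index is large enough both for the relation modulo [p^k] and for [p^k] to divide
   its factorial. *)
have dE := hN (maxn N0 (p ^ k)) (leq_maxl _ _).
have dN : ((p ^ k)%N%:Z %| (maxn N0 (p ^ k))`!%:Z)%Z.
  by rewrite dvdzE /= dvdn_fact // leq_maxr expn_gt0 prime_gt0.
rewrite -[pade_form _ _ _ _](subrK (b * pade_rem x n (maxn N0 (p ^ k)))).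
by rewrite rpredD ?pade_form_congr // dvdz_mull // (dvdz_trans dk) // dvdz_pade_rem.
Qed.

End PadicDivisibility.

(** * Products over primes and the final contradiction *)

Lemma prod_pfactor_dvdn (s : seq prime_number) (e : prime_number -> nat) m :
  uniq s -> (forall p : prime_number, p \in s -> (p ^ e p %| m)%N) ->
  (\prod_(p <- s) p ^ e p %| m)%N.
Proof.
elim: s => [|q s IH]; first by rewrite big_nil dvd1n.
rewrite big_cons /= => /andP[qs us] h.
rewrite Gauss_dvd ?h ?mem_head ?IH // => [p ps|]; first by rewrite h // inE ps orbT.
rewrite big_seq; elim/big_ind: _ => [|u v cu cv|p ps]; first exact: coprimen1.
  by rewrite coprimeMr cu cv.
rewrite coprimeXl // coprimeXr // prime_coprime ?prime_valP //.
rewrite dvdn_prime2 ?prime_valP //; apply: contra qs => /eqP qp.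
by rewrite (_ : q = p) //; apply: val_inj.
Qed.

Lemma limn_esup_lt (R : realType) (u : nat -> \bar R) (c : \bar R) :
  (limn_esup u < c)%E -> exists N, forall n, (N <= n)%N -> (u n < c)%E.
Proof.
rewrite /limn_esup limf_esupE => /ereal_inf_lt[_ [V [N _ NV] <-]] uc.
exists N => n Nn; rewrite (le_lt_trans _ uc) //.
by apply: ereal_sup_ubound; exists n => //; exact: NV.
Qed.

Lemma primes_le_seq (U : set prime_number) m : exists2 s : seq prime_number, uniq s &
  forall p, (p \in s) = (p \in U) && (p <= m)%N.
Proof.
have : finite_set (U `&` prime_val @^-1` [set k | (k <= m)%N]).
  apply: sub_finite_set (@subIsetr _ _ _) _; apply: finite_preimage.
    by move=> p q _ _; exact: val_inj.
  exact: (sub_finite_set _ (finite_II m.+1)).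
move=> /finite_seqP[s Us]; exists (undup s); first exact: undup_uniq.
move=> p; rewrite mem_undup.
have -> : (p \in s) = (p \in [set` s]) by apply/idP/idP; rewrite inE.
by rewrite -Us in_setI; congr andb; apply/idP/idP; rewrite inE.
Qed.

(** A prime above [m] cannot divide [z], so its factor is 1. Leaving [m] free lets one list serve
    several integers. *)
Lemma padic_abs_prod_fin (R : realType) (U : set prime_number) (z : int) m :
  z != 0 -> (`|z| %| m)%N -> (0 < m)%N ->
  forall s : seq prime_number, uniq s ->
  (forall p, (p \in s) = (p \in U) && (p <= m)%N) ->
  \big[*%R/1]_(p \in U) padic_abs R p z%:~R ^+ 2 =
  \prod_(p <- s) padic_abs R p z%:~R ^+ 2.
Proof.
move=> z0 zm m0 s us sU; rewrite (fsbig_seq _ _ us).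
apply/esym/fsbig_widen => p.
  by move=> /=; rewrite sU => /andP[]; rewrite inE.
move=> [Up /= /negP]; rewrite sU mem_set //= => pm.
rewrite padic_abs_intE // logn_coprime ?expr0 ?invr1 ?expr1n //.
rewrite prime_coprime ?prime_valP //; apply: contra pm => pz.
by rewrite dvdn_leq // (dvdn_trans pz).
Qed.

(** Let [P] be the part of [(n! x^n)^2] supported on [U]. The p-adic factors multiply to [1/P], and
    [P] divides the nonzero form, so [P] is at most the bound of [pade_form_le]. *)
Lemma euler_bound_ge (R : realType) (U : set prime_number) (x a b : int) n :
  x != 0 ->
  (forall p, U p -> a%:~R - b%:~R * euler_factorial_series (x%:~R : Qp R p) = 0) ->
  pade_form a b x n != 0 ->
  1 <= (`|a| + `|b|)%:~R * (euler_const R x U ^+ n * n`!%:R * fact_padic_prod R U n).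
Proof.
move=> x0 rel D0; set D := pade_form a b x n in D0.
have f0 : n`!%:Z != 0 by rewrite -lt0n fact_gt0.
(* Both [n!] and [|x|] divide [m], so the primes up to [m] suffice for both products. *)
set m := (n`! * `|x|)%N; have m0 : (0 < m)%N by rewrite muln_gt0 fact_gt0 absz_gt0.
have [s us sU] := primes_le_seq U m.
rewrite /euler_const /fact_padic_prod.
rewrite (padic_abs_prod_fin R x0 _ m0 us sU) ?dvdn_mull //.
under eq_fsbigr do rewrite (_ : n`!%:R = n`!%:Z%:~R :> rat) //.
rewrite (padic_abs_prod_fin R f0 _ m0 us sU) ?dvdn_mulr //.
pose M := (n`!%:Z * x ^+ n) ^+ 2.
have M0 : M != 0 by rewrite expf_neq0 // mulf_neq0 // expf_neq0.
have eM : (\prod_(p <- s) padic_abs R p x%:~R ^+ 2) ^+ n *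
    \prod_(p <- s) padic_abs R p n`!%:~R ^+ 2 =
    ((\prod_(p <- s) p ^ logn p `|M|)%N%:R)^-1.
  rewrite -prodrXl -big_split /= natr_prod -prodfV; apply: eq_bigr => p _.
  rewrite natrX -padic_abs_intE // /M rmorphXn rmorphM rmorphXn /=.
  by rewrite !padic_absX padic_absM padic_absX [RHS]exprMn [RHS]mulrC exprAC.
have dD : (\prod_(p <- s) p ^ logn p `|M| %| `|D|)%N.
  apply: prod_pfactor_dvdn => // p; rewrite sU => /andP[/set_mem Up _].
  have := @pade_form_pfactor_dvdz R p x a b n (logn p `|M|) (rel p Up).
  by rewrite !dvdzE /=; apply; rewrite pfactor_dvdnn.
set P := (\prod_(p <- s) p ^ logn p `|M|)%N in eM dD.
have P0 : (0 < P)%N by rewrite (dvdn_gt0 _ dD) // absz_gt0.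
have DP : P%:R <= (`|D|%N)%:R :> R by rewrite ler_nat dvdn_leq // absz_gt0.
have DC : (`|D|%N)%:R <= (`|a| + `|b|)%:~R * (4 * `|x|%:~R) ^+ n * n`!%:R :> R.
  have := pade_form_le a b n x0; rewrite -/D -(ler_int R) !rmorphM rmorphXn rmorphM /=.
  by rewrite !rmorph_nat -abszE -pmulrn.
rewrite [X in X * _ * _]exprMn -!mulrA (mulrCA _ n`!%:R) eM !mulrA.
by rewrite ler_pdivlMr ?ltr0n // mul1r (le_trans DP).
Qed.

Theorem theorem1 (R : realType) (xi a b : int) (T : set prime_number) :
  xi != 0 -> b != 0 ->
  (forall S : set prime_number, finite_set S -> S `<=` T ->
    limn_esup (fun n : nat =>
      ((euler_const R xi (T `\` S)) ^+ n * n`!%:R *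
        fact_padic_prod R (T `\` S) n)%:E) = 0%E) ->
  infinite_set [set p : prime_number | T p /\
    a%:~R - b%:~R * euler_factorial_series (xi%:~R : Qp R p) != 0].
Proof.
move=> xi0 b0 lim0; set S := [set p | _] => finS.
have ST : S `<=` T by move=> p [].
have C0 : 0 < (`|a| + `|b|)%:~R :> R.
  by rewrite ltr0z ltr_wpDl // normr_gt0.
(* The threshold is the lower bound given by [euler_bound_ge]: any nonzero form beyond [N]
   contradicts it. *)
have : (0 < ((`|a| + `|b|)%:~R^-1 : R)%:E)%E by rewrite lte_fin invr_gt0.
rewrite -[X in (X < _)%E](lim0 S finS ST) => /limn_esup_lt[N ltN].
have rel (p : prime_number) : (T `\` S) p ->
    a%:~R - b%:~R * euler_factorial_series (xi%:~R : Qp R p) = 0.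
  by move=> [Tp nSp]; apply: contrapT => /eqP Lp; apply: nSp.
have [n Nn Dn] : exists2 n, (N <= n)%N & pade_form a b xi n != 0.
  by case/orP: (pade_form_neq0 a N xi0 b0) => D0; [exists N|exists N.+1].
have := ltN n Nn; rewrite lte_fin -[X in _ < X]mulr1 ltr_pdivlMl // ltNge.
by rewrite (euler_bound_ge xi0 rel Dn).
Qed.
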